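(* There are positive constants $c_3$ and $c_4$ such that for all positive integers $n,k$, every graph $G$ on $n$ vertices is $k$-universal or satisfies $$\hom(G) \geq c_3\, 2^{c_4\sqrt{\frac{\log n}{k}}}\log n.$$
   Context: All graphs are finite and simple; $\log$ is to base $2$. A graph is $k$-universal if it contains every graph on at most $k$ vertices as an induced subgraph. $\hom(G)$ denotes the size of the largest homogeneous subset of vertices of $G$, i.e. the largest set of vertices that is either a clique or an independent set. *)

(* Defs.v *)
From mathcomp Require Import all_boot all_order all_algebra.
From mathcomp Require Import reals exp.

Set Implicit Arguments.
Unset Strict Implicit.
Unset Printing Implicit Defensive.

Import Order.TTheory GRing.Theory Num.Theory.

Record sgraph := SGraph {
  vertex :> finType;
  adj : rel vertex;
  adj_sym : symmetric adj;
  adj_irrefl : irreflexive adj }.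

Arguments adj {s}.

Definition induced_subgraph (H G : sgraph) : Prop :=
  exists f : H -> G, injective f /\ forall x y, adj (f x) (f y) = adj x y.

Definition universal (k : nat) (G : sgraph) : Prop :=
  forall H : sgraph, #|H| <= k -> induced_subgraph H G.

Definition clique (G : sgraph) (A : {set G}) : bool :=
  [forall x in A, forall y in A, (x != y) ==> adj x y].

Definition independent (G : sgraph) (A : {set G}) : bool :=
  [forall x in A, forall y in A, ~~ adj x y].

Definition homogeneous (G : sgraph) (A : {set G}) : bool :=
  clique A || independent A.

Definition hom_number (G : sgraph) : nat :=
  \max_(A : {set G} | homogeneous A) #|A|.

Local Open Scope ring_scope.

Definition log2 (R : realType) (x : R) : R := ln x / ln 2.

(* Main.v *)
Require Import Defs.
From mathcomp Require Import all_boot all_order all_algebra.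
From mathcomp Require Import boolp reals exp.
From mathcomp Require Import zify lra.

(** Let [l] be the integer part of log n and suppose that some graph [H] on at
    most [k] vertices is not induced in [G].  The proof has two halves, and both
    treat adjacency and non-adjacency as the two colors of a 2-colored complete
    graph, so that everything is symmetric under complementation.

    The first half is a form of Rodl's theorem in the quantitative version of
    Fox and Sudakov.  Trying to embed [H] greedily, vertex by vertex, must fail;
    the failure exhibits two large disjoint sets [A], [B] such that, for one of
    the two colors, every vertex of [A] sends few edges of that color to [B]
    ([induced_or_lopsided]).  Applying this recursively inside [A] and inside a
    suitable half of [B], and keeping track of how often each color occurred,
    gives a set [W] of at least 2^(l/2) vertices in which one color has density
    about 2^-h ([sparse_or_dense_subset]).  Every level of the recursion costs
    a factor 2^(O(h k)) and there are at most 2h levels, so this works as long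
    as h^2 k = O(l); hence 2^h can be of order 2^(c sqrt(l/k)).

    The second half is a weak form of a theorem of Erdos and Szemeredi: if the
    color [c] is that sparse in [W], then there is a homogeneous set of size
    T = 2^t m, where 2^t is of order 2^h and m of order l/h
    ([sparse_large_homogeneous]).  Let [X] be a largest set without color [c]
    among the vertices of low [c]-degree, and suppose |X| < T.  By double
    counting, a positive proportion of the vertices have fewer than [m]
    [c]-neighbors in [X], and there are so few possible neighborhoods that many
    vertices, forming a set [U'], have all of them inside one set [P] of fewer
    than [m] vertices ([common_pattern]).  By the unbalanced Ramsey theorem
    ([unbalanced_ramsey]) [U'] contains a set [I] of [m] vertices without color
    [c], unless there is already a homogeneous set of size [T].  Exchanging [P]
    for [I] enlarges [X], a contradiction.

    Since 2^t m is at least of order 2^(t/2) l, this gives the theorem when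
    l/k is large.  When l/k is bounded, the claim is Ramsey's theorem
    hom(G) >= l/2, up to rounding. *)

Set Implicit Arguments.
Unset Strict Implicit.
Unset Printing Implicit Defensive.

Import Order.TTheory GRing.Theory Num.Theory.
Local Open Scope nat_scope.

(** * Two-colored complete graphs *)

(** The colors are [true] for edges and [false] for non-edges; excluding the
    diagonal makes the two colors exchange under complementation. *)
Definition colored {V : finType} (e : rel V) (c : bool) : rel V :=
  fun x y => (x != y) && (e x y == c).

Definition nbhd {V : finType} (e : rel V) (c : bool) (x : V) (A : {set V}) :
  {set V} := [set y in A | colored e c x y].

Definition mono {V : finType} (e : rel V) (c : bool) (A : {set V}) : bool :=
  [forall x in A, forall y in A, (x != y) ==> (e x y == c)].

Section ColoredPairs.

Variables (V : finType) (e : rel V).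
Hypothesis e_sym : symmetric e.
Implicit Types (c : bool) (x y : V) (A B U W X : {set V}).

Lemma colored_sym c : symmetric (colored e c).
Proof. by move=> x y; rewrite /colored eq_sym e_sym. Qed.

Lemma nbhd_sub c x A : nbhd e c x A \subset A.
Proof. by apply/subsetP => y; rewrite inE => /andP[]. Qed.

Lemma nbhdU c x A B : [disjoint A & B] ->
  #|nbhd e c x (A :|: B)| = #|nbhd e c x A| + #|nbhd e c x B|.
Proof.
move=> dAB; have -> : nbhd e c x (A :|: B) = nbhd e c x A :|: nbhd e c x B.
  by apply/setP=> y; rewrite !inE andb_orl.
rewrite cardsU; suff -> : nbhd e c x A :&: nbhd e c x B = set0.
  by rewrite cards0 subn0.
apply/eqP; rewrite setI_eq0.
exact: disjointWl (nbhd_sub _ _ _) (disjointWr (nbhd_sub _ _ _) dAB).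
Qed.

Lemma double_count c A B :
  \sum_(x in A) #|nbhd e c x B| = \sum_(y in B) #|nbhd e c y A|.
Proof.
have E x D : #|nbhd e c x D| = \sum_(y in D) colored e c x y.
  by rewrite -sum1dep_card big_mkcondr; apply: eq_bigr => y _; case: colored.
under eq_bigr => x _ do rewrite E.
under [RHS]eq_bigr => y _ do rewrite E.
rewrite exchange_big; apply: eq_bigr => y _.
by apply: eq_bigr => x _; rewrite colored_sym.
Qed.

Lemma markov_count A (f : V -> nat) t :
  #|[set x in A | t <= f x]| * t <= \sum_(x in A) f x.
Proof.
rewrite -sum_nat_const (bigID [pred x | t <= f x] (mem A)) /=.
apply: leq_trans (leq_addr _ _).
rewrite (eq_bigl (fun x => (x \in A) && (t <= f x))); last by move=> x; rewrite inE.
by apply: leq_sum => x /andP[].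
Qed.

Lemma subset_of_card A q : q <= #|A| -> exists2 B : {set V}, B \subset A & #|B| = q.
Proof.
move=> qA; exists [set x in take q (enum A)].
  by apply/subsetP => x; rewrite inE => /mem_take; rewrite mem_enum.
rewrite cardsE; have /card_uniqP -> : uniq (take q (enum A)).
  exact/take_uniq/enum_uniq.
by rewrite size_takel // -cardE.
Qed.

Lemma monoP c A :
  reflect (forall x y, x \in A -> y \in A -> x != y -> e x y = c) (mono e c A).
Proof.
apply: (iffP forall_inP) => [H x y xA yA xy|H x xA].
  by move/forall_inP: (H x xA) => /(_ y yA)/implyP/(_ xy)/eqP.
by apply/forall_inP => y yA; apply/implyP => xy; apply/eqP; apply: H.
Qed.

Lemma mono0 c : mono e c set0.
Proof. by apply/monoP => x y; rewrite inE. Qed.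

Lemma mono_nbhdU1 c x U A : A \subset nbhd e c x U -> mono e c A ->
  mono e c (x |: A) /\ x \notin A.
Proof.
move=> /subsetP AN /monoP mA.
have xA y : y \in A -> x != y /\ e x y = c.
  by move=> /AN; rewrite inE => /andP[_ /andP[-> /eqP->]].
split; last by apply/negP => /xA[]; rewrite eqxx.
apply/monoP => y z; rewrite !inE => /orP[/eqP->|yA] /orP[/eqP->|zA].
- by rewrite eqxx.
- by move=> _; case: (xA z zA).
- by move=> _; rewrite e_sym; case: (xA y yA).
- exact: mA.
Qed.

(** The usual recursion R(a,b) <= R(a-1,b) + R(a,b-1), solved by
    g^a (g/(g-1))^b because 1/g + (g-1)/g = 1.  The free parameter [g] is what
    makes the bound efficient when [b] is much larger than [a]: one takes [g]
    of order [b/a].  The power of [g-1] is multiplied out to stay among natural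
    numbers, and the successor makes the two inductive bounds add up exactly. *)
Lemma unbalanced_ramsey c g a b U : 0 < g ->
  (forall A : {set V}, A \subset U -> mono e c A -> #|A| < a) ->
  (forall B : {set V}, B \subset U -> mono e (~~ c) B -> #|B| < b) ->
  #|U|.+1 * g.-1 ^ b <= g ^ (a + b).
Proof.
move=> g0; elim: {a b}(a + b) {-2}a {-2}b (erefl (a + b)) U => [|n IH] a b.
  move=> ab U /(_ _ (sub0set _) (mono0 _)); rewrite cards0; lia.
move=> ab U Ha Hb; have a0 : 0 < a.
  by have := Ha _ (sub0set _) (mono0 _); rewrite cards0.
have b0 : 0 < b.
  by have := Hb _ (sub0set _) (mono0 _); rewrite cards0.
case: (set_0Vmem U) => [->|[x xU]].
  rewrite cards0 mul1n (@leq_trans (g ^ b)) ?leq_pexp2l ?leq_addl //.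
  by rewrite leq_exp2r ?leq_pred.
have cardU : #|U| = (#|nbhd e c x U| + #|nbhd e (~~ c) x U|).+1.
  rewrite (cardsD1 x) xU add1n; congr _.+1.
  rewrite -[RHS](cardsUI); have -> : nbhd e c x U :&: nbhd e (~~ c) x U = set0.
    apply/setP => y; rewrite !inE /colored; case: (_ \in U) => //=.
    by case: (x != y) => //=; case: (e x y) (c) => [] [].
  rewrite cards0 addn0; apply: eq_card => y; rewrite !inE /colored [x == y]eq_sym.
  by case: (y == x) (y \in U) (e x y) (c) => [] [] [] [].
have grow d B t : B \subset nbhd e d x U -> mono e d B ->
    (forall A : {set V}, A \subset U -> mono e d A -> #|A| < t) -> #|B| < t.-1.
  move=> BN mB Ht; have [mB' xB] := @mono_nbhdU1 _ _ _ _ BN mB.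
  have := Ht (x |: B); rewrite cardsU1 xB mB' => H.
  have /H : x |: B \subset U.
    by rewrite subUset sub1set xU (subset_trans BN) ?nbhd_sub.
  by move=> /(_ isT); lia.
have N1 : #|nbhd e c x U|.+1 * g.-1 ^ b <= g ^ n.
  have -> : n = a.-1 + b by lia.
  apply: IH; first lia.
    by move=> A AN mA; apply: (grow c).
  by move=> B BN; apply: Hb; apply: subset_trans BN (nbhd_sub _ _ _).
have N2 : #|nbhd e (~~ c) x U|.+1 * g.-1 ^ b.-1 <= g ^ n.
  have -> : n = a + b.-1 by lia.
  apply: IH; first lia.
    by move=> A AN; apply: Ha; apply: subset_trans AN (nbhd_sub _ _ _).
  by move=> B BN mB; apply: (grow (~~ c)).
rewrite cardU ab.
have -> : g ^ n.+1 = g ^ n + g.-1 * g ^ n by rewrite -mulSn prednK // expnS.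
have e1 : g.-1 ^ b = g.-1 * g.-1 ^ b.-1 by rewrite -expnS prednK.
have N3 : #|nbhd e (~~ c) x U|.+1 * g.-1 ^ b <= g.-1 * g ^ n.
  by rewrite e1 mulnCA leq_mul2l N2 orbT.
rewrite -addSn -addnS mulnDl; exact: leq_add.
Qed.

(** This replaces counting the small subsets of [X].  The vertices of [X] are
    processed one at a time; those of [U] either mostly avoid the current vertex
    [x], which costs a factor (g-1)/g, or at least a fraction 1/g of them are
    joined to [x], which costs [g] but uses up one of the [q] allowed
    neighbors. *)
Lemma common_pattern c g q X U : 1 < g ->
  (forall u, u \in U -> #|nbhd e c u X| <= q) ->
  exists U' P : {set V}, [/\ U' \subset U, P \subset X, #|P| <= q,
    forall u x, u \in U' -> x \in X :\: P -> ~~ colored e c u x &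
    #|U| * g.-1 ^ #|X| <= #|U'| * g ^ (q + #|X|)].
Proof.
move=> g1; elim: {X}#|X| {-2}X (erefl #|X|) U q => [|n IH] X cX U q HU.
  exists U, set0; split; rewrite ?sub0set ?cards0 //.
    by move=> u x _; rewrite (cards0_eq cX) setD0 inE.
  by rewrite cX expn0 leq_mul2l expn_gt0 ltnW ?orbT // ltnW.
case: (set_0Vmem U) => [->|[u0 u0U]].
  exists set0, set0; split; rewrite ?sub0set ?cards0 //.
  by move=> u x; rewrite inE.
have [x xX] : exists x, x \in X by apply/card_gt0P; rewrite cX.
have cX' : #|X :\ x| = n by move: cX; rewrite (cardsD1 x) xX => -[].
have degX u : #|nbhd e c u X| = colored e c u x + #|nbhd e c u (X :\ x)|.
  rewrite (cardsD1 x) inE xX; congr (_ + #|pred_of_set _|).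
  by apply/setP => y; rewrite !inE; case: (y == x).
pose N := nbhd e c x U; pose M := U :\: N.
have NU : N \subset U := nbhd_sub _ _ _.
have cU : #|U| = #|N| + #|M| by rewrite -(cardsID N U) (setIidPr NU).
have MP u : u \in M -> u \in U /\ colored e c u x = false.
  by rewrite !inE negb_and => /andP[/orP[/negPf ->//|/negPf]]; rewrite colored_sym.
have [bigN|smallN] := boolP (#|U| <= #|N| * g).
  have N0 : 0 < #|N|.
    by rewrite lt0n; apply: contraL bigN => /eqP->; rewrite -ltnNge; apply/card_gt0P; exists u0.
  have NP u : u \in N -> u \in U /\ colored e c u x.
    by rewrite !inE colored_sym => /andP[].
  have q0 : 0 < q.
    case/card_gt0P: N0 => u /NP[uU cu].
    by have := HU u uU; rewrite degX cu; lia.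
  have [|U' [P [sU sP cP HP HC]]] := IH _ cX' N q.-1.
    by move=> u /NP[uU cu]; have := HU u uU; rewrite degX cu; lia.
  exists U', (x |: P); split.
  - exact: subset_trans NU.
  - by rewrite subUset sub1set xX (subset_trans sP) ?subsetDl.
  - by rewrite cardsU1; case: (x \notin P); lia.
  - move=> u y uU'; rewrite !inE negb_or -andbA => /and3P[yx yP yX].
    by apply: HP => //; rewrite !inE yx yP yX.
  rewrite cX' in HC; rewrite cX expnS; have -> : q + n.+1 = (q.-1 + n).+2 by lia.
  apply: (@leq_trans (#|N| * g * (g * g.-1 ^ n))).
    by apply: leq_mul => //; rewrite leq_mul2r leq_pred orbT.
  rewrite !expnS; move: HC; set a := _ ^ n; set b := _ ^ _.
  by rewrite -(@leq_pmul2r (g * g)); [lia|rewrite muln_gt0; lia].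
have [|U' [P [sU sP cP HP HC]]] := IH _ cX' M q.
  by move=> u /MP[uU cu]; have := HU u uU; rewrite degX cu.
exists U', P; split => //.
- exact: subset_trans sU (subsetDl _ _).
- exact: subset_trans sP (subsetDl _ _).
- move=> u y uU'; case: (y =P x) => [-> _|/eqP yx].
    by have [_ ->] := MP _ (subsetP sU _ uU').
  by rewrite !inE => H; apply: HP => //; rewrite !inE yx.
have HM : #|U| * g.-1 <= #|M| * g by move: smallN; nia.
rewrite cX' in HC; rewrite cX addnS !expnS mulnA.
apply: (leq_trans (leq_mul HM (leqnn _))).
by rewrite -mulnA mulnCA [leqRHS]mulnCA leq_mul2l HC orbT.
Qed.

End ColoredPairs.

(** * Failure of the greedy embedding *)

(** The sparseness is required from every vertex of [A], so it survives
    shrinking [A]; it says nothing about single vertices of [B]. *)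
Definition lopsided_pair {V : finType} (e : rel V) (D Q : nat) (U : {set V}) :=
  exists c, exists A B : {set V}, [/\ A \subset U, B \subset U, [disjoint A & B],
    Q <= #|A| /\ Q <= #|B| & forall x, x \in A -> #|nbhd e c x B| * D <= #|B|].

Section GreedyEmbedding.

Variables (V : finType) (e : rel V).
Hypothesis e_sym : symmetric e.

Lemma disjoint_blocks (T : eqType) (s : seq T) q (U : {set V}) :
  uniq s -> size s * q <= #|U| ->
  exists C : T -> {set V},
    [/\ forall w, w \in s -> C w \subset U, forall w, w \in s -> #|C w| = q &
        {in s &, forall w w', w != w' -> [disjoint C w & C w']}].
Proof.
elim: s U => [|w s IH] U /=; first by move=> _ _; exists (fun=> set0); split.
rewrite mulSn => /andP[ws us] qU.
have [|A AU cA] := subset_of_card (A := U) (q := q); first exact: leq_trans (leq_addr _ _) qU.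
have [//||C [CU cC dC]] := IH (U :\: A).
  by rewrite -(leq_add2l q) (leq_trans qU) // -(cardsID A U) (setIidPr AU) cA.
have dA u : u \in s -> [disjoint A & C u].
  move=> /CU; rewrite subsetD => /andP[_]; by rewrite disjoint_sym.
have neq u : u \in s -> (u == w) = false.
  by move=> us'; apply/negbTE; apply: contraNneq ws => <-.
exists (fun u => if u == w then A else C u); split.
- move=> u; rewrite inE; case: eqP => //= _ /CU /subset_trans; apply.
  exact: subsetDl.
- by move=> u; rewrite inE; case: eqP => //= _ /cC.
- move=> u u'; rewrite !inE => /orP[/eqP->|us1] /orP[/eqP->|us2].
  + by rewrite eqxx.
  + by move=> _; rewrite eqxx neq // dA.
  + by move=> _; rewrite eqxx neq // disjoint_sym dA.
  + by move=> ?; rewrite !neq //; apply: dC.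
Qed.

(** [C w] holds the candidates for the image of [w] that are compatible with the
    vertices embedded so far.  The next vertex can be placed if some candidate
    [v] keeps a fraction 1/D of every other candidate set.  Otherwise each
    candidate spoils some [C u], and by pigeonhole many spoil the same one: they
    form the set [A], with [B := C u]. *)
Lemma greedy_embedding (T : eqType) (h : rel T) (v0 : V) D Q (U : {set V}) s
    (C : T -> {set V}) :
  symmetric h -> 1 < D -> 0 < Q -> uniq s ->
  (forall w, w \in s -> C w \subset U) ->
  (forall w, w \in s -> Q * D ^ size s <= #|C w|) ->
  {in s &, forall w w', w != w' -> [disjoint C w & C w']} ->
  lopsided_pair e D Q U \/
  exists2 f : T -> V, forall w, w \in s -> f w \in C w &
    {in s &, forall w w', w != w' -> e (f w) (f w') = h w w'}.
Proof.
move=> hsym D1 Q0; elim: s C => [|w s IH] C /=.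
  by move=> *; right; exists (fun=> v0).
move=> /andP[ws us] CU cC dC.
have neq u : u \in s -> (w == u) = false.
  by move=> us'; apply/negbTE; apply: contraNneq ws => ->.
have inS u : u \in s -> u \in w :: s by rewrite inE orbC => ->.
have inW : w \in w :: s by rewrite inE eqxx.
have [/exists_inP[v vC /allP goodv]|] := boolP [exists v in C w,
    all (fun u => #|C u| <= #|nbhd e (h w u) v (C u)| * D) s].
  have [|u us'|u u' us1 us2 uu'|//|[f fC fh]] := IH (fun u => nbhd e (h w u) v (C u)) us.
  - by move=> u us'; apply: subset_trans (CU _ (inS _ us')); apply: nbhd_sub.
  - rewrite -(@leq_pmul2r D) ?(ltnW D1) // -mulnA -expnSr.
    exact: leq_trans (cC _ (inS _ us')) (goodv _ us').
  - apply: disjointWl (nbhd_sub _ _ _ _) (disjointWr (nbhd_sub _ _ _ _) _).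
    by apply: dC => //; apply: inS.
  - by left.
  right; exists (fun u => if w == u then v else f u) => [u|u u'].
    rewrite inE eq_sym; case: eqP => [<- //|_ /= /fC].
    exact/subsetP/nbhd_sub.
  have ev x : x \in s -> e v (f x) = h w x.
    by move=> /fC; rewrite inE => /andP[_ /andP[_ /eqP]].
  rewrite !inE => /orP[/eqP->|us1] /orP[/eqP->|us2].
  - by rewrite eqxx.
  - by move=> _; rewrite eqxx neq // ev.
  - by move=> _; rewrite eqxx neq // e_sym hsym ev.
  - by move=> ?; rewrite !neq //; apply: fh.
rewrite negb_exists_in => /forall_inP bad; left.
pose A u := [set v in C w | #|nbhd e (h w u) v (C u)| * D < #|C u|].
have [/hasP[u us' QA]|] := boolP (has (fun u => Q <= #|A u|) s).
  exists (h w u), (A u), (C u); split.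
  - by apply: subset_trans (CU _ inW); apply/subsetP=> x; rewrite inE => /andP[].
  - exact/CU/inS.
  - apply: (@disjointWl _ _ (C w)); first by apply/subsetP=> x; rewrite inE => /andP[].
    by apply: dC => //; [exact: inS|rewrite neq].
  - split=> //; apply: leq_trans (cC _ (inS _ us')).
    by rewrite leq_pmulr // expn_gt0 ltnW.
  - by move=> x; rewrite inE => /andP[_ /ltnW].
rewrite -all_predC => /allP small.
suff : #|C w| <= size s * Q.
  have := cC _ inW; move=> H1 H2; have := leq_trans H1 H2.
  rewrite mulnC leq_pmul2r // leqNgt; have := ltn_expl (size s).+1 D1; lia.
(* Every candidate spoils some [C u], so the [A u] cover [C w]. *)
have covered : #|C w| <= \sum_(u <- s) #|A u|.
  apply: (@leq_trans #|\bigcup_(u <- s) A u|).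
    apply/subset_leq_card/subsetP => v vC.
    have := bad v vC; rewrite -has_predC => /hasP[u us' /= ub].
    rewrite (big_rem u) //= inE; apply/orP; left.
    by rewrite inE vC ltnNge.
  elim/big_ind2: _ => [|X a Y b Xa Yb|//]; first by rewrite cards0.
  by rewrite (leq_trans (leq_card_setU _ _)) ?leq_add.
apply: leq_trans covered _.
rewrite -sum1_size big_distrl /=; rewrite big_seq [leqRHS]big_seq.
by apply: leq_sum => u /small /=; rewrite -ltnNge mul1n => /ltnW.
Qed.

End GreedyEmbedding.

(** Start from disjoint candidate sets, so that the embedding found is
    injective.  The factor 2^k pays for cutting [U] into at most k <= 2^k
    blocks. *)
Lemma induced_or_lopsided (G H : sgraph) k D Q (U : {set G}) :
  #|H| <= k -> 1 < D -> 0 < Q -> Q * (2 * D) ^ k <= #|U| ->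
  induced_subgraph H G \/ lopsided_pair (@adj G) D Q U.
Proof.
move=> Hk D1 Q0 cU.
have D0 : 0 < D by apply: ltnW.
have [v0 _] : exists v0, v0 \in U.
  by apply/card_gt0P; apply: leq_trans cU; rewrite muln_gt0 Q0 expn_gt0 muln_gt0 D0.
have [|//|C [CU cC dC]] := @disjoint_blocks G H (enum H) (Q * D ^ #|H|) U.
- exact: enum_uniq.
- apply: leq_trans cU; rewrite -cardE mulnCA leq_mul2l; apply/orP; right.
  apply: (@leq_trans (2 ^ k * D ^ k)); last by rewrite expnMn.
  apply: leq_mul; last by rewrite leq_pexp2l.
  by apply: leq_trans Hk (ltnW _); apply: ltn_expl.
have mH x : x \in enum H by rewrite mem_enum.
have cC' w : w \in enum H -> Q * D ^ size (enum H) <= #|C w|.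
  by move=> /cC ->; rewrite -cardE.
have [|[f fC fh]] := greedy_embedding (@adj_sym G) v0 (@adj_sym H) D1 Q0
  (enum_uniq H) CU cC' dC; first by right.
left; exists f.
have finj : injective f.
  move=> x y fxy; apply/eqP; apply: contraT => xy.
  have := dC x y (mH _) (mH _) xy; rewrite disjoints_subset => /subsetP /(_ (f x)).
  by rewrite fC // => /(_ isT); rewrite inE fxy fC.
split=> // x y; case: (x =P y) => [->|/eqP xy]; first by rewrite !adj_irrefl.
exact: fh.
Qed.

(** * A large subset in which one color is sparse *)

Section SparseSubset.

Variables (V : finType) (e : rel V).
Hypothesis e_sym : symmetric e.

(** The pairs are ordered: each edge is counted twice. *)
Definition edge_count c (W : {set V}) := \sum_(x in W) #|nbhd e c x W|.

Lemma edge_countU c (W1 W2 : {set V}) : [disjoint W1 & W2] ->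
  edge_count c (W1 :|: W2) =
  edge_count c W1 + edge_count c W2 + 2 * \sum_(y in W2) #|nbhd e c y W1|.
Proof.
move=> dW; rewrite /edge_count.
rewrite (eq_bigl [predU W1 & W2]); last by move=> x; rewrite !inE.
rewrite bigU //=; under eq_bigr => x _ do rewrite nbhdU //.
under [X in _ + X]eq_bigr => x _ do rewrite nbhdU //.
rewrite !big_split /= (double_count e_sym c W1 W2); lia.
Qed.

Lemma edge_count_le c (W : {set V}) : edge_count c W <= #|W| * #|W|.
Proof.
rewrite -sum_nat_const; apply: leq_sum => x _.
exact/subset_leq_card/nbhd_sub.
Qed.

(** The recursion merges two sets of the same color level: the cross pairs have
    density at most 2^-h, while each of the 2^(a c) final blocks of [s] vertices
    may be complete.  These are the second and the first summand of the bound.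
    Two separate counters are needed because the color of the lopsided pair is
    not under control: a pair of color [c] lowers only the counter of [c], and
    the other color, if it is the one that succeeds inside [A] or [B], is passed
    on unchanged. *)
Lemma sparse_or_dense_subset k h s :
  0 < s ->
  (forall Q (U : {set V}), 0 < Q -> Q * (2 ^ h.+2) ^ k <= #|U| ->
     lopsided_pair e (2 ^ h.+1) Q U) ->
  forall n (a : bool -> nat) (U : {set V}), a true + a false = n ->
    s * (2 * (2 ^ h.+2) ^ k) ^ n <= #|U| ->
  exists c, exists W : {set V}, [/\ W \subset U, #|W| = 2 ^ a c * s &
    edge_count c W * 2 ^ h <= 2 ^ h * 2 ^ a c * s ^ 2 + 4 ^ a c * s ^ 2].
Proof.
move=> s0 pair n; set L := (2 ^ h.+2) ^ k.
have L0 : 0 < L by rewrite !expn_gt0.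
elim: n => [|n IH] a U an cU.
all: have [[c ac0]|anz] : (exists c, a c = 0) \/ (forall c, 0 < a c)
  by case: (posnP (a true)) => [|at0]; [left; exists true|
     case: (posnP (a false)) => [|af0]; [left; exists false|right; case]].
(* A color whose counter is zero asks for a single block. *)
1,3: have [|W WU cW] := subset_of_card (A := U) (q := s);
  [by apply: leq_trans cU; rewrite leq_pmulr // expn_gt0 muln_gt0 L0
  |exists c, W; split; rewrite ?ac0 ?mul1n //].
1,2: apply: leq_trans (leq_addr _ _);
  rewrite muln1 mulnC leq_mul2l; apply/orP; right;
  by apply: (leq_trans (edge_count_le _ _)); rewrite cW.
  by have := anz true; lia.
pose Q := 2 * s * (2 * L) ^ n.
have [||c [A [B [AU BU dAB [QA QB] AB]]]] := pair Q U.
- by rewrite !muln_gt0 s0 /= expn_gt0 muln_gt0 L0.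
- apply: leq_trans cU; rewrite -/L /Q expnS; apply/eq_leq; lia.
pose a' d := if d == c then (a d).-1 else a d.
have an' : a' true + a' false = n.
  by move: (anz true) (anz false); rewrite /a'; case: (c) => /=; lia.
have Qs : s * (2 * L) ^ n <= Q by rewrite /Q; lia.
have [d [W1 [W1A cW1 eW1]]] := IH a' A an' (leq_trans Qs QA).
case: (d =P c) => [dc|/eqP dc]; last first.
  exists d, W1; move: cW1 eW1; rewrite /a' (negbTE dc) => cW1 eW1.
  by split=> //; apply: subset_trans AU.
subst d; move: cW1 eW1; rewrite {1 2 3}/a' eqxx => cW1 eW1.
have W10 : 0 < #|W1| by rewrite cW1 muln_gt0 expn_gt0.
(* The second set is looked for among the vertices of [B] that are sparse to
   [W1]; since [D = 2 * 2 ^ h], these are at least half of [B]. *)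
pose B' := [set y in B | #|nbhd e c y W1| * 2 ^ h <= #|W1|].
have B'B : B' \subset B by apply/subsetP=> y; rewrite inE => /andP[].
have cB : #|B| <= 2 * #|B'|.
  have bad : #|B :\: B'| * #|W1| * 2 <= #|B| * #|W1|.
    apply: (@leq_trans ((\sum_(y in B) #|nbhd e c y W1|) * 2 ^ h * 2)).
      rewrite leq_mul2r /= big_distrl /=.
      apply: leq_trans (markov_count B (fun y => #|nbhd e c y W1| * 2 ^ h) #|W1|).
      rewrite leq_mul2r; apply/orP; right; apply/subset_leq_card/subsetP => y.
      by rewrite !inE => /andP[]; case: (y \in B) => //=; rewrite -ltnNge => /ltnW.
    rewrite -(double_count e_sym) -mulnA -expnSr big_distrl /= mulnC -sum_nat_const.
    by apply: leq_sum => x xW; apply: AB; apply: (subsetP W1A).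
  have := cardsID B' B; rewrite (setIidPr B'B).
  by move: bad; nia.
have [d [W2 [W2B cW2 eW2]]] := IH a' B' an' ltac:(move: Qs QB; rewrite /Q; lia).
have W2B' := subset_trans W2B B'B.
case: (d =P c) => [dc|/eqP dc]; last first.
  exists d, W2; move: cW2 eW2; rewrite /a' (negbTE dc) => cW2 eW2.
  by split=> //; apply: subset_trans W2B' _.
subst d; move: cW2 eW2; rewrite {1 2 3}/a' eqxx => cW2 eW2.
have dW : [disjoint W1 & W2] by apply: disjointWl W1A (disjointWr W2B' dAB).
have ac : 2 ^ a c = 2 * 2 ^ (a c).-1 by rewrite -expnS prednK.
have ac4 : 4 ^ a c = 4 * (2 ^ (a c).-1 * 2 ^ (a c).-1).
  by rewrite -expnMn -expnS prednK.
have ac4' : 4 ^ (a c).-1 = 2 ^ (a c).-1 * 2 ^ (a c).-1 by rewrite -expnMn.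
exists c, (W1 :|: W2); split.
- by rewrite subUset (subset_trans W1A AU) (subset_trans W2B' BU).
- by rewrite cardsU disjoint_setI0 // cards0 cW1 cW2 ac; lia.
have cross : (\sum_(y in W2) #|nbhd e c y W1|) * 2 ^ h <= #|W2| * #|W1|.
  rewrite big_distrl -sum_nat_const; apply: leq_sum => y yW.
  by have := subsetP W2B _ yW; rewrite inE => /andP[].
rewrite edge_countU //; move: cross eW1 eW2.
rewrite cW1 cW2 ac ac4 ac4' -!mulnn.
move: (\sum_(_ in _) _) (edge_count _ _) (edge_count _ _) (2 ^ h) (2 ^ _).
by move=> S E1 E2 p t cross eW1 eW2; nia.
Qed.

End SparseSubset.

(** * Sparse graphs have large homogeneous sets *)

(** Bernoulli's inequality (1 - 1/g)^i >= 1 - i/g, with denominators cleared. *)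
Lemma bernoulli_nat g i : i <= g -> g ^ i * (g - i) <= g * g.-1 ^ i.
Proof.
elim: i => [|i IH] ig; first by rewrite !expn0 mul1n muln1 subn0.
have {}IH := IH (ltnW ig); rewrite !expnS.
apply: (@leq_trans (g.-1 * (g ^ i * (g - i)))).
  by rewrite -mulnA mulnCA [leqRHS]mulnCA leq_mul2l; apply/orP; right; nia.
by rewrite [leqRHS]mulnCA leq_mul2l IH orbT.
Qed.

(** With g = 2v, Bernoulli gives (g/(g-1))^v <= 2; hence the factors g/(g-1)
    that occur up to v m times cost only 2^m. *)
Lemma expn_pred_ratio v m x : 0 < v -> x <= v * m ->
  (2 * v) ^ x <= 2 ^ m * (2 * v).-1 ^ x.
Proof.
move=> v0 xvm; have one : (2 * v) ^ v <= 2 * (2 * v).-1 ^ v.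
  have := @bernoulli_nat (2 * v) v ltac:(lia).
  by rewrite {2}mul2n -addnn addnK -mulnA [leqRHS]mulnCA mulnC leq_pmul2l.
have g1 : 0 < (2 * v).-1 by lia.
rewrite -(@leq_pmul2r ((2 * v).-1 ^ (v * m - x))) ?expn_gt0 ?g1 //.
rewrite -mulnA -expnD subnKC //.
apply: (@leq_trans ((2 * v) ^ (v * m))).
  rewrite -[in leqRHS](subnKC xvm) expnD leq_mul2l; apply/orP; right.
  by case: (v * m - x) => // j; rewrite leq_exp2r ?leq_pred.
by rewrite !expnM -expnMn; case: (m) => // j; rewrite leq_exp2r.
Qed.

Section ErdosSzemeredi.

Variables (V : finType) (e : rel V).
Hypothesis e_sym : symmetric e.

Lemma monoW c (A B : {set V}) : A \subset B -> mono e c B -> mono e c A.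
Proof.
move=> /subsetP AB /monoP mB; apply/monoP => x y /AB xB /AB yB; exact: mB.
Qed.

(** The unbalanced Ramsey theorem with g = 2^(t+1), the value suited to a ratio
    2^t between the two sizes. *)
Lemma mono_small_homog_subset c t m (U : {set V}) :
  2 ^ (t.+2 * m) <= #|U| ->
  (forall A : {set V}, mono e c A -> #|A| < 2 ^ t * m) ->
  exists I : {set V}, [/\ I \subset U, mono e (~~ c) I & m <= #|I|].
Proof.
move=> cU small.
have [/existsP[I /and3P[]]|] := boolP [exists I : {set V},
    [&& I \subset U, mono e (~~ c) I & m <= #|I|]]; first by exists I.
rewrite negb_exists => /forallP noI.
have g1 : 0 < (2 * 2 ^ t).-1 by have := expn_gt0 2 t; lia.
have g0 : 0 < 2 * 2 ^ t by lia.
have noI' (A : {set V}) : A \subset U -> mono e (~~ c) A -> #|A| < m.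
  by move=> AU mA; have := noI A; rewrite AU mA /= -ltnNge.
have small' (B : {set V}) : B \subset U -> mono e (~~ ~~ c) B -> #|B| < 2 ^ t * m.
  by move=> _; rewrite negbK; apply: small.
have H := unbalanced_ramsey e_sym g0 noI' small'.
have R := @expn_pred_ratio (2 ^ t) m (2 ^ t * m) (expn_gt0 2 t) (leqnn _).
exfalso; have : #|U|.+1 <= 2 ^ (t.+2 * m).
  rewrite -(@leq_pmul2r ((2 * 2 ^ t).-1 ^ (2 ^ t * m))) ?expn_gt0 ?g1 //.
  apply: leq_trans H _; rewrite expnD.
  have -> : 2 ^ (t.+2 * m) = (2 * 2 ^ t) ^ m * 2 ^ m.
    by rewrite expnM -expnMn -expnS mulnC -expnS.
  by rewrite -mulnA leq_mul2l R orbT.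
by rewrite ltnNge cU.
Qed.

(** The exponent t + 4 is chosen so that at most a quarter of the vertices of [W]
    have [m] or more [c]-neighbors in [X], while at least half of [W] has low
    [c]-degree.  At least one eighth of [W] is then left for the pattern
    argument, which loses 2^((t+2) m), as does the Ramsey argument. *)
Lemma sparse_large_homogeneous c t m (W : {set V}) :
  0 < m -> edge_count e c W * 2 ^ (t + 4) <= 2 * #|W| ^ 2 ->
  2 ^ (2 * t.+2 * m + 3) <= #|W| ->
  exists d, exists2 A : {set V}, mono e d A & 2 ^ t * m <= #|A|.
Proof.
move=> m0 eW cW; set T := 2 ^ t * m.
have [/existsP[A /andP[]]|] := boolP [exists A : {set V}, mono e c A && (T <= #|A|)].
  by exists c, A.
rewrite negb_exists => /forallP noc.
have small (A : {set V}) : mono e c A -> #|A| < T.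
  by move=> mA; have := noc A; rewrite mA /= -ltnNge.
(* [Z] is the set of vertices of low [c]-degree, where [X] is maximal. *)
pose Z := [set x in W | #|nbhd e c x W| * 2 ^ t.+2 <= #|W|].
have ZW : Z \subset W by apply/subsetP=> x; rewrite inE => /andP[].
pose P0 (A : {set V}) := (A \subset Z) && mono e (~~ c) A.
have P00 : P0 set0 by rewrite /P0 sub0set mono0.
have [X /andP[XZ mX] maxX] := arg_maxnP (fun A : {set V} => #|A|) P00.
have [XT|XT] := leqP T #|X|; first by exists (~~ c), X.
have W0 : 0 < #|W| by apply: leq_trans cW; rewrite expn_gt0.
have pt : 2 ^ t.+2 = 4 * 2 ^ t by rewrite !expnS mulnA.
have cZ : #|W| <= 2 * #|Z|.
  have bad : #|W :\: Z| * #|W| * 4 <= 2 * #|W| ^ 2.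
    apply: leq_trans eW; have -> : 2 ^ (t + 4) = 2 ^ t.+2 * 4.
      by rewrite -(expnD 2 _ 2); congr (_ ^ _); lia.
    rewrite mulnA leq_mul2r /= /edge_count big_distrl /=.
    apply: leq_trans (markov_count W (fun y => #|nbhd e c y W| * 2 ^ t.+2) #|W|).
    rewrite leq_mul2r; apply/orP; right; apply/subset_leq_card/subsetP => y.
    by rewrite !inE => /andP[]; case: (y \in W) => //=; rewrite -ltnNge => /ltnW.
  by have := cardsID Z W; rewrite (setIidPr ZW); nia.
(* [X] itself is removed so that the set exchanged for [P] is disjoint from it. *)
pose U := [set u in Z :\: X | #|nbhd e c u X| <= m.-1].
have cU : #|W| <= 8 * #|U|.
  pose Y := [set u in W | m <= #|nbhd e c u X|].
  have cY : #|Y| * 4 <= #|W|.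
    have : #|Y| * m <= \sum_(x in X) #|nbhd e c x W|.
      by rewrite (double_count e_sym); apply: markov_count.
    have : (\sum_(x in X) #|nbhd e c x W|) * 2 ^ t.+2 <= #|X| * #|W|.
      rewrite big_distrl -sum_nat_const; apply: leq_sum => x /(subsetP XZ).
      by rewrite inE => /andP[].
    have := expn_gt0 2 t; rewrite pt; move: XT; rewrite /T.
    move: (\sum_(_ in _) _) (2 ^ t) => S v XT v0 H1 H2.
    have H3 : #|Y| * m * (4 * v) <= v * m * #|W|.
      apply: (@leq_trans (S * (4 * v))); first by rewrite leq_mul2r H2 orbT.
      by apply: leq_trans H1 _; rewrite leq_mul2r ltnW ?orbT.
    by rewrite -(@leq_pmul2r (m * v)) ?muln_gt0 ?m0 //; lia.
  have cT : 8 * T <= #|W|.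
    apply: leq_trans cW; rewrite expnD [leqRHS]mulnC leq_mul2l /T.
    apply: (@leq_trans (2 ^ t * 2 ^ m)).
      by rewrite leq_mul2l (ltnW (ltn_expl _ _)) ?orbT.
    by rewrite -expnD leq_pexp2l //; nia.
  have : Z \subset U :|: X :|: Y.
    apply/subsetP => u uZ; have uW := subsetP ZW _ uZ.
    rewrite !inE uW; move: uZ; rewrite inE uW /= => ->.
    by case: (u \in X) => //=; case: leqP => //=; lia.
  move/subset_leq_card; have [+ _] := leq_card_setU (U :|: X) Y.
  by have [+ _] := leq_card_setU U X; lia.
have g1 : 1 < 2 * 2 ^ t by have := expn_gt0 2 t; lia.
have [|U' [P [U'U PX cP HP HC]]] := @common_pattern _ _ e_sym c (2 * 2 ^ t) m.-1 X U g1.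
  by move=> u; rewrite inE => /andP[].
have cU' : 2 ^ (t.+2 * m) <= #|U'|.
  have gp : 0 < (2 * 2 ^ t).-1 by lia.
  have UU' : #|U| <= #|U'| * 2 ^ (t.+2 * m).
    rewrite -(@leq_pmul2r ((2 * 2 ^ t).-1 ^ #|X|)) ?expn_gt0 ?gp //.
    apply: leq_trans HC _; rewrite -mulnA leq_mul2l; apply/orP; right.
    have -> : 2 ^ (t.+2 * m) = (2 * 2 ^ t) ^ m * 2 ^ m.
      by rewrite expnM -expnMn -expnS mulnC -expnS.
    rewrite expnD -mulnA; apply: leq_mul; first by rewrite leq_pexp2l ?leq_pred 1?ltnW.
    by apply: expn_pred_ratio; rewrite ?expn_gt0 // ltnW.
  have := leq_trans cW cU; rewrite expnD mulnC leq_pmul2l // => H.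
  rewrite -(@leq_pmul2r (2 ^ (t.+2 * m))) ?expn_gt0 // -expnD.
  by apply: leq_trans UU'; apply: leq_trans H; rewrite leq_pexp2l // addnn -mul2n mulnA.
have [I [IU' mI cI]] := mono_small_homog_subset cU' small.
have IU := subset_trans IU' U'U.
have IX u : u \in I -> u \in Z /\ u \notin X.
  by move/(subsetP IU); rewrite in_set => /andP[]; rewrite in_setD => /andP[-> ->].
exfalso; have : P0 (X :\: P :|: I).
  apply/andP; split.
    rewrite subUset (subset_trans (subsetDl _ _) XZ) /=.
    by apply/subsetP => u /IX[].
  have cross u x : u \in I -> x \in X :\: P -> e u x = ~~ c.
    move=> uI xX; have := HP u x (subsetP IU' _ uI) xX; rewrite /colored.
    have -> : u != x.
      by apply: contraTneq xX => <-; rewrite in_setD (negbTE (IX u uI).2) andbF.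
    by rewrite /= negb_eqb addbC => /addbP.
  apply/monoP => x y; rewrite !(in_setU _ _ I) => /orP[xX|xI] /orP[yX|yI] xy.
  - by move/monoP: (monoW (subsetDl X P) mX); apply.
  - by rewrite e_sym cross.
  - exact: cross.
  - by move/monoP: mI; apply.
move/maxX => /=; rewrite leqNgt => /negP; apply.
have dXI : [disjoint X :\: P & I].
  rewrite disjoint_sym disjoints_subset; apply/subsetP => u /IX[_ uX].
  by rewrite !inE (negbTE uX) andbF.
rewrite cardsU disjoint_setI0 // cards0 subn0 cardsD (setIidPr PX).
have := subset_leq_card PX; lia.
Qed.

End ErdosSzemeredi.

(** * Homogeneous sets of graphs *)

Lemma mono_hom_number (G : sgraph) c (A : {set G}) :
  mono (@adj G) c A -> #|A| <= hom_number G.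
Proof.
move=> /monoP mA; suff hA : homogeneous A by apply: leq_bigmax_cond.
apply/orP; case: c mA => mA; [left|right].
  apply/forall_inP => x xA; apply/forall_inP => y yA; apply/implyP; exact: mA.
apply/forall_inP => x xA; apply/forall_inP => y yA.
by case: (x =P y) => [->|/eqP xy]; rewrite ?adj_irrefl // mA.
Qed.

Lemma ramsey_hom_number (G : sgraph) a : 4 ^ a <= #|G| -> a <= hom_number G.
Proof.
move=> cG; rewrite leqNgt; apply/negP => small.
have small' c (A : {set G}) : A \subset [set: G] -> mono (@adj G) c A -> #|A| < a.
  by move=> _ /mono_hom_number cA; apply: leq_ltn_trans small.
have := @unbalanced_ramsey _ _ (@adj_sym G) true 2 a a [set: G] isT
  (small' true) (small' false).
rewrite exp1n muln1 cardsT addnn -mul2n expnM => H.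
by have := leq_trans H cG; rewrite ltnn.
Qed.

(** The two halves are combined with h = t + 4: the recursion runs over at most
    2h levels at a cost of 2^((h+3)k) each, and leaves blocks of size 2^mu. *)
Lemma induced_or_large_hom (G H : sgraph) k t m mu :
  #|H| <= k -> 0 < k -> 0 < m -> 2 * t.+2 * m + 3 <= mu ->
  2 ^ (mu + 2 * (t + 4) * (t + 7) * k) <= #|G| ->
  induced_subgraph H G \/ 2 ^ t * m <= hom_number G.
Proof.
move=> Hk k0 m0 hmu cG; case: (EM (induced_subgraph H G)) => [|noH]; [by left|right].
have pair Q (U : {set G}) : 0 < Q -> Q * (2 ^ (t + 4).+2) ^ k <= #|U| ->
    lopsided_pair (@adj G) (2 ^ (t + 4).+1) Q U.
  move=> Q0; rewrite (expnS 2 _.+1) => cU.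
  by case: (induced_or_lopsided Hk _ Q0 cU) => //; rewrite -{1}(expn0 2) ltn_exp2l.
have [||c [W [_ cW eW]]] := @sparse_or_dense_subset _ _ (@adj_sym G) k (t + 4)
   (2 ^ mu) (expn_gt0 _ _) pair (t + 4 + (t + 4)) (fun=> t + 4) [set: G] => //.
  rewrite cardsT; apply: leq_trans cG; rewrite [leqRHS]expnD leq_mul2l -expnM -expnS -expnM.
  by apply/orP; right; rewrite leq_pexp2l //; nia.
have [||d [A mA cA]] := @sparse_large_homogeneous _ _ (@adj_sym G) c t m W m0.
- apply: leq_trans eW _; rewrite cW expnMn.
  have -> : 4 ^ (t + 4) = 2 ^ (t + 4) * 2 ^ (t + 4) by rewrite -expnMn.
  by rewrite -!mulnn; lia.
- rewrite cW (@leq_trans (2 ^ mu)) ?leq_pexp2l // leq_pmull // expn_gt0 //.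
- exact: leq_trans cA (mono_hom_number mA).
Qed.

Lemma hom_number_gt0 (G : sgraph) : 0 < #|G| -> 0 < hom_number G.
Proof.
case/card_gt0P => x _; rewrite -(cards1 x).
apply: (@mono_hom_number _ true); apply/monoP => y z.
by rewrite !inE => /eqP-> /eqP->; rewrite eqxx.
Qed.

(** In the last case [t] is the largest value permitted by
    [induced_or_large_hom] with [mu] about [l/2], and [m] is of order [l/t];
    maximality of [t] gives t + 8 >= sqrt(l/k)/2.  The threshold 112 = 4 * 4 * 7
    is the value of l/k from which on t = 0 is permitted. *)
Lemma hom_number_cases (G H : sgraph) k l :
  #|H| <= k -> 0 < k -> 0 < l -> 2 ^ l <= #|G| ->
  [\/ induced_subgraph H G,
      l <= 3 * hom_number G /\ l <= 112 * k |
      exists t m, [/\ l <= 16 * (t + 2) * m, l <= 4 * (t + 8) ^ 2 * k &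
        2 ^ t * m <= hom_number G]].
Proof.
move=> Hk k0 l0 cG; have [kl|kl] := leqP l (112 * k).
  constructor 2; split=> //.
  have := @hom_number_gt0 G (leq_trans _ cG); rewrite expn_gt0 => /(_ isT).
  have : l %/ 2 <= hom_number G.
    apply: ramsey_hom_number; apply: leq_trans cG.
    by rewrite -(expnM 2 2) leq_pexp2l //; lia.
  lia.
pose p t := 4 * (t + 4) * (t + 7) * k <= l.
have p0 : exists t, p t by exists 0; rewrite /p; lia.
have pl t : p t -> t <= l by rewrite /p; nia.
have [t pt tmax] := ex_maxnP p0 pl.
have qt : l < 4 * (t + 5) * (t + 8) * k.
  by rewrite ltnNge; apply/negP => H1; have := tmax t.+1; rewrite /p; lia.
pose mu := l %/ 2; pose m := (mu - 3) %/ (2 * t.+2).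
have hl : 4 * (t + 4) * (t + 7) <= l by move: pt; rewrite /p; nia.
have m0 : 0 < m by rewrite divn_gt0 // /mu; nia.
have m1 : m * (2 * t.+2) <= mu - 3 by apply: leq_divM.
have m2 : mu - 3 < m.+1 * (2 * t.+2) by apply: ltn_ceil.
have [||ind|hom] := @induced_or_large_hom G H k t m mu Hk k0 m0.
- by move: m1; rewrite /mu; nia.
- apply: leq_trans cG; rewrite leq_pexp2l // /mu.
  by move: pt; rewrite /p; lia.
- by constructor 1.
constructor 3; exists t, m; split=> //; last by rewrite -mulnn; nia.
move: m2; rewrite /mu; nia.
Qed.

Lemma sqr_le_expn2 t : (t + 2) ^ 2 <= 8 * 2 ^ t.
Proof. by rewrite -mulnn; elim: t => // -[//|t] IH; rewrite expnS; nia. Qed.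

Local Open Scope ring_scope.

(** * Passing to real numbers *)

Lemma log2_le (R : realType) n l : (0 < n)%N -> (n < 2 ^ l)%N ->
  log2 (n%:R : R) <= l%:R.
Proof.
move=> n0 nl; have ln2 : 0 < ln (2 : R) by rewrite ln_gt0 // ltr1n.
rewrite /log2 ler_pdivrMr // mulr_natl -lnXn // ler_ln ?posrE ?ltr0n ?exprn_gt0 //.
by rewrite -natrX ler_nat ltnW.
Qed.

Lemma powR_sqrt_le (R : realType) (x b : R) : 0 <= b -> x <= b ^+ 2 ->
  2 `^ (1 / 6 * Num.sqrt x) <= 2 `^ (1 / 6 * b).
Proof.
move=> b0 xb; apply: ler_powR; first by rewrite ler1n.
rewrite ler_pM2l //; last lra.
by rewrite -(ger0_norm b0) -sqrtr_sqr ler_wsqrtr.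
Qed.

Theorem theorem1p2 (R : realType) :
  exists c3 c4 : R, 0 < c3 /\ 0 < c4 /\
    forall n k : nat, (0 < n)%N -> (0 < k)%N ->
    forall G : sgraph, #|G| = n ->
      universal k G \/
      (hom_number G)%:R >=
        c3 * 2 `^ (c4 * Num.sqrt (log2 n%:R / k%:R)) * log2 n%:R.
Proof.
exists (1 / 1536), (1 / 6); do 2![split; first lra].
move=> n k n0 k0 G Gn; case: lerP => [|small]; [by right|left=> H Hk].
have [n1|n1] := leqP n 1.
  have e1 : n = 1%N by lia.
  by move: small; rewrite e1 /log2 ln1 mul0r mulr0 ltNge ler0n.
have /andP[lel ltl] := trunc_log_bounds (ltnSn 1) n0.
set l := trunc_log 2 n in lel ltl.
have l0 : (0 < l)%N by rewrite lt0n; apply: contraTneq ltl => ->; rewrite -leqNgt.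
have L2 : log2 n%:R <= 2 * l%:R :> R.
  by rewrite (le_trans (log2_le _ n0 ltl)) // -natrM ler_nat; lia.
have L0 : 0 <= log2 n%:R :> R.
  by rewrite /log2 divr_ge0 ?ln_ge0 // ler1n.
have kR : 0 < k%:R :> R by rewrite ltr0n.
(* All bounds on l/k enter through a [b] with sqrt(log n / k) <= b. *)
have key (b : nat) : (2 * l <= b ^ 2 * k)%N ->
    2 `^ (1 / 6 * Num.sqrt (log2 n%:R / k%:R)) <= 2 `^ (1 / 6 * b%:R) :> R.
  move=> lb; apply: powR_sqrt_le; rewrite ?ler0n // ler_pdivrMr //.
  by rewrite (le_trans L2) // -natrX -!natrM ler_nat.
move: small key; set p := 2 `^ _; set L := log2 _ in L0 L2 *; move=> small key.
have pp : 0 <= p by apply: powR_ge0.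
rewrite -Gn in lel.
have [//|[l3 lk]|[t [m [lm lt hom]]]] := hom_number_cases Hk k0 l0 lel; exfalso.
  have p8 : p <= 8.
    apply: (le_trans (key 15%N _)); first by lia.
    have -> : 8 = 2 `^ 3%:R :> R by rewrite powR_mulrn ?ler0n // -natrX.
    by rewrite ler_powR ?ler1n //; lra.
  have l3R : l%:R <= 3 * (hom_number G)%:R :> R by rewrite -natrM ler_nat.
  have : p * L <= 8 * L by apply: ler_wpM2r.
  have : 0 < l%:R :> R by rewrite ltr0n.
  move: small; rewrite -mulrA; lra.
(* [y] is 2^(t/2): one factor [y] bounds the exponential, the other absorbs
   the [t + 2] lost in [l <= 16 (t + 2) m]. *)
pose y : R := 2 `^ (1 / 2 * t%:R).
have y0 : 0 < y by apply: powR_gt0; rewrite ltr0n.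
have yy : y * y = 2 ^+ t.
  rewrite -powRD; last by rewrite pnatr_eq0 implybT.
  by rewrite -powR_mulrn ?ler0n //; congr (_ `^ _); lra.
have py : p <= 16 * y.
  apply: (le_trans (key (3 * (t + 8))%N _)); first by lia.
  have -> : 16 = 2 `^ 4%:R :> R by rewrite powR_mulrn ?ler0n // -natrX.
  rewrite -powRD; last by rewrite pnatr_eq0 implybT.
  by rewrite ler_powR ?ler1n // natrM natrD; lra.
have ty : (t + 2)%:R <= 3 * y.
  rewrite -(@ler_pXn2r _ 2) ?nnegrE ?ler0n ?mulr_ge0 ?(ltW y0) ?ler0n //.
  rewrite exprMn [y ^+ 2]expr2 yy -!natrX -natrM ler_nat.
  by apply: leq_trans (sqr_le_expn2 t) _; rewrite leq_mul2r orbT.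
have lmR : l%:R <= 16 * (t + 2)%:R * m%:R :> R by rewrite -!natrM ler_nat.
have homR : y * y * m%:R <= (hom_number G)%:R.
  by rewrite yy -natrX -natrM ler_nat.
have mR : 0 <= m%:R :> R by apply: ler0n.
have LB : L <= 96 * (y * m%:R).
  apply: (le_trans L2); apply: (le_trans (ler_wpM2l _ lmR)); first by [].
  have := ler_wpM2r mR ty; lra.
have : p * L <= 16 * y * (96 * (y * m%:R)).
  by apply: ler_pM.
move: small homR; rewrite -mulrA; lra.
Qed.
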